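(* Let $B$ be a pattern set (a set of permutations, containing no redundancies) and let $p\in B$. Then there always exists a functional equation for the cluster tail generating function $F(k,p;[z_1,\ldots,z_{|p|}])$ of the form $$F(k,p;[z_1,\ldots,z_{|p|}]) = (t-1)\sum_{p'\in B}\ \sum_{i\in I(p')} R_i\cdot F(k_i,p';[M^i_1,\ldots,M^i_{|p'|}]),$$ where $I(p')$ is a finite index set for each $p'\in B$, $I(p')$ and $I(p'')$ are disjoint if $p'\neq p''$, each $M^i_j$ is a specific monomial in $z_1,\ldots,z_{|p|}$, each $R_i$ is a specific rational expression in $z_1,\ldots,z_{|p|}$, and $k_i<k$ for each $i$.
   Context: For a sequence $\sigma=\sigma_1\cdots\sigma_k$ of distinct positive integers, the reduction $\rho(\sigma)$ is the permutation of $\{1,\ldots,k\}$ whose entries are in the same relative order as those of $\sigma$. For a permutation $p$, $|p|$ denotes its length, and $\mathcal{S}_n$ denotes the set of permutations of length $n$. A permutation $\sigma\in\mathcal{S}_n$ contains $p\in\mathcal{S}_m$ (consecutively), where $m\le n$, if $\rho(\sigma_i\cdots\sigma_{i+m-1})=p$ for some $1\le i\le n-m+1$. A set $B$ of permutations contains no redundancies if there are no $p_1,p_2\in B$ with $p_1\ne p_2$ such that $p_1$ contains $p_2$. A cluster of length $k$ (with respect to $B$) is an ordered pair $(\pi;[[i_1,j_1],\ldots,[i_r,j_r]])$ such that: (a) $\pi\in\mathcal{S}_k$; (b) $i_1=1$, $j_r=k$, and $i_n<i_{n+1}\le j_n$ for $1\le n\le r-1$ (each interval overlaps the neighboring interval,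 and the intervals cover $\pi$); (c) $\rho(\pi_{i_n}\cdots\pi_{j_n})\in B$ for all $1\le n\le r$. The weight of such a cluster is $(t-1)^r$, where $t$ is a variable (used to track occurrences of patterns). For $p\in B$ with $|p|=m$ and $x_1<x_2<\cdots<x_m$, let $C(k,p;[x_1,\ldots,x_m])$ be the sum of the weights of all clusters of length $k$ such that $\rho(\pi_{i_r}\cdots\pi_{j_r})=p$ (the cluster ends in the pattern $p$) and the last $m$ terms of $\pi$ are, as a set, $\{x_1,\ldots,x_m\}$. The cluster tail generating function is $$F(k,p;[z_1,\ldots,z_m])=\sum_{1\le x_1<\cdots<x_m\le k} C(k,p;[x_1,\ldots,x_m])\,z_1^{x_1}\cdots z_m^{x_m}.$$
   Formalization: The equation is proved for all k ≥ 1 with k ≠ |p|; at k = |p| it fails, since F(|p|,p) = (t-1)z_1 z_2^2⋯z_m^m while the right side is divisible by (t-1)^2, and at k = 0 no k_i < k exists. *)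

(* Defs.v *)
From HB Require Import structures.
From mathcomp Require Import all_boot all_order all_algebra finmap.
From mathcomp Require Import boolp classical_sets functions cardinality fsbigop.
From mathcomp Require Import mpoly.

Set Implicit Arguments.
Unset Strict Implicit.
Unset Printing Implicit Defensive.

Import GRing.Theory.
Local Open Scope ring_scope.

(* A permutation of length n is the word of its values, in one-line notation:
   a rearrangement of 1, ..., n. *)
Definition is_perm (s : seq nat) : bool := perm_eq s (iota 1 (size s)).

(* Each entry is replaced by its rank; meant for words without repetition. *)
Definition reduction (s : seq nat) : seq nat :=
  [seq count (fun y => y <= x)%N s | x <- s].

(* s_i ... s_j, with positions counted from 1 and both ends included. *)
Definition factor (s : seq nat) (i j : nat) : seq nat := drop i.-1 (take j s).

(* For i >= 1, the bound on i says i + size p - 1 <= size s. *)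
Definition contains (s p : seq nat) : Prop :=
  exists i : nat, [/\ (1 <= i)%N, ((i + size p).-1 <= size s)%N &
                      reduction (factor s i (i + size p).-1) = p].

Definition pattern_set (B : set (seq nat)) : Prop :=
  (forall p, B p -> is_perm p) /\
  (forall p q, B p -> B q -> p <> q -> ~ contains p q).

(* The second component lists the intervals [i_n, j_n] as pairs (i_n, j_n).
   The default (0, 0) makes the condition on i_1 fail for the empty list. *)
Definition cluster (B : set (seq nat)) (k : nat)
    (c : seq nat * seq (nat * nat)) : Prop :=
  let: (pi, w) := c in
  [/\ perm_eq pi (iota 1 k),
      [/\ (head (0, 0) w).1 = 1, (last (0, 0) w).2 = k &
          sorted (fun u v => u.1 < v.1 <= u.2)%N w],
      {in w, forall u, u.1 <= u.2 <= k}%N &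
      {in w, forall u, B (reduction (factor pi u.1 u.2))}].

(* Clusters of length k ending in the pattern p, and whose last size p entries
   form the set x; as these entries are distinct, perm_eq is equality of sets
   when x is duplicate-free. *)
Definition clusters_with_tail (B : set (seq nat)) (k : nat) (p x : seq nat) :
    set (seq nat * seq (nat * nat)) :=
  [set c | [/\ cluster B k c,
               reduction (factor c.1 (last (0, 0) c.2).1 (last (0, 0) c.2).2) = p &
               perm_eq (drop (k - size p) c.1) x]].

(* This set is finite (finite_clusters_with_tail below), so the sum
   over it is a genuine finite sum. *)
Definition tail_weight (A : comNzRingType) (t : A) (B : set (seq nat))
    (k : nat) (p x : seq nat) : A :=
  \sum_(c \in clusters_with_tail B k p x) (t - 1) ^+ size c.2.

(* F(k, p; [z_1, ..., z_m]) with m = size p, evaluated at arguments in any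
   commutative ring; z_{j+1} is z j.  The path condition reads
   0 < x_1 < ... < x_m. *)
Definition cluster_tail_gf (A : comNzRingType) (t : A) (B : set (seq nat))
    (k : nat) (p : seq nat) (z : 'I_(size p) -> A) : A :=
  \sum_(x : (size p).-tuple 'I_k.+1 | path ltn 0%N (map val x))
     tail_weight t B k p (map val x) * \prod_(j < size p) z j ^+ tnth x j.
Arguments cluster_tail_gf {A} t B k p z.

Definition ratfun (m : nat) : fieldType := {fraction {mpoly rat[m]}}.

Definition ratfun_monomial (m : nat) (u : 'X_{1..m}) : ratfun m :=
  FracField.tofrac ('X_[u] : {mpoly rat[m]}).

Definition ratfun_var (m : nat) (j : 'I_m) : ratfun m := ratfun_monomial U_(j)%MM.

Lemma finite_clusters_with_tail (B : set (seq nat)) (k : nat) (p x : seq nat) :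
  finite_set (clusters_with_tail B k p x).
Proof.
pose T := ('I_k.+1 * 'I_k.+1)%type.
pose X := (k.-tuple 'I_k.+1 * {r : 'I_(#|{: T}|.+1) & r.-tuple T})%type.
pose h (u : T) : nat * nat := (val u.1, val u.2).
pose f (a : X) := (map val a.1, map h (tagged a.2)).
apply: (@sub_finite_set _ _ (f @` [set: X])%classic); last first.
  exact/finite_image/finite_finset.
move=> [pi w] [] [Hpi [_ _ Hs] Hw _] _ _.
pose g (u : nat * nat) : T := (inord u.1, inord u.2).
have gK : {in w, cancel g h}.
  move=> u /Hw /andP[u12 u2k]; rewrite /h /g /= !inordK ?ltnS //.
    by case: u {u12 u2k}.
  exact: leq_trans u12 u2k.
have uw : uniq w.
  apply: (@sorted_uniq _ (fun u v : nat * nat => u.1 < v.1)%N).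
  - by move=> a b c; exact: ltn_trans.
  - by move=> a; exact: ltnn.
  - by apply: sub_sorted Hs => a b /andP[].
have sz : (size (map g w) < #|{: T}|.+1)%N.
  rewrite ltnS cardT; apply: uniq_leq_size => [|a _]; last exact: mem_enum.
  by rewrite map_inj_in_uniq // => a b /gK {2}<- /gK {2}<- ->.
have szpi : size (map (@inord k) pi) == k.
  by rewrite size_map (perm_size Hpi) size_iota.
exists (Tuple szpi, Tagged (fun r : 'I_(#|{: T}|.+1) => r.-tuple T)
   (in_tuple (map g w) : (Ordinal sz).-tuple T)) => //.
rewrite /f /= -!map_comp; congr pair.
  rewrite -[RHS]map_id; apply/eq_in_map => a.
  by rewrite (perm_mem Hpi) mem_iota add1n => /andP[_ ak] /=; rewrite inordK.
by rewrite -[RHS]map_id; apply/eq_in_map => a /gK.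
Qed.

(* No strictly increasing tail fits below k < size p; hence, for an infinite B
   as well, only finitely many p in B give a nonzero generating function for a
   bounded k. *)
Lemma cluster_tail_gf_eq0 (A : comNzRingType) (t : A) (B : set (seq nat))
    (k : nat) (p : seq nat) (z : 'I_(size p) -> A) :
  (k < size p)%N -> cluster_tail_gf t B k p z = 0.
Proof.
move=> ltkp; apply: big1 => x px; exfalso.
have ux : uniq (0%N :: map val x).
  by apply: (@sorted_uniq _ ltn); [exact: ltn_trans | exact: ltnn | ].
have : (size (0%N :: map val x) <= size (iota 0 k.+1))%N.
  apply: uniq_leq_size => // a; rewrite mem_iota in_cons add0n /=.
  by case/predU1P => [->|/mapP[b _ ->]] //; exact: ltn_ord.
by rewrite /= size_map size_tuple size_iota ltnS leqNgt ltkp.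
Qed.

(* Main.v *)
Require Import Defs.
From HB Require Import structures.
From mathcomp Require Import all_boot all_order all_algebra finmap.
From mathcomp Require Import boolp classical_sets functions cardinality fsbigop.
From mathcomp Require Import mpoly.
From mathcomp Require Import zify ring.

Set Implicit Arguments.
Unset Strict Implicit.
Unset Printing Implicit Defensive.

Import GRing.Theory.
Local Open Scope ring_scope.

(** Every cluster of length k > |p| ending in p is obtained in exactly one way
    from a shorter cluster, its parent: delete the last interval and reduce the
    part of the permutation that the other intervals cover.  No pattern of B
    contains another, so the right ends of the intervals of a cluster strictly
    increase [cluster_ends_increase]; hence the parent is a cluster, of length
    k - |p| + o where o, with 0 < o < |p|, is the length of the overlap of the
    last two intervals [parent_ending].

    Conversely, fix a parent ending in q, with tail values y_1 < ... < y_|q|,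
    and an overlap o.  The word of an extension is known as soon as the set
    x_1 < ... < x_|p| of its last |p| values is: the entries of p after the
    overlap say which x_v are new values, and the entries of the parent are
    relabelled increasingly by the remaining values [extend].  Such an x comes
    from an extension exactly when, for each entry v of p inside the overlap,
    x_v is the value y_s of the same entry in the parent, increased by the
    number of new values below it [parent_valid, extend_ending].  That number
    depends only on p, o and v.  So x runs over the increasing sequences in
    1, ..., k with the values at some positions prescribed and the other
    values free, and the sum over clusters becomes a sum over q, o, parents
    and such x [sum_by_parent].

    For a fixed parent, the sum of z^x over these x is an iterated geometric
    sum [sum_fillings]: a free value between neighbours a < b contributes
    (r^(a+1) - r^b) / (1 - r), where r is a nonconstant monomial, and thus
    disappears in favour of powers with exponents a and b.  What remains is a
    finite sum of terms, each a rational function times monomials raised to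
    the prescribed values y_s + constant and to the upper bound k + 1.  The
    constants and the upper bound go into the coefficient R; collecting the
    powers of each y_s gives the argument M, which is therefore the same for
    all k [sum_tails].  Summing over all parents turns each term into a value
    of the generating function of q at length k - |p| + o.

    The index of a term is a number coding the triple of q, o and the position
    of the term in the list of terms, which makes the index sets of different
    patterns disjoint.  When k < |p| both sides vanish. *)

(** * Ranks, reductions and relabellings of words *)

Section Words.
Local Open Scope nat_scope.
Implicit Types (s p x U : seq nat).

Definition rank s v := count (fun y => y <= v) s.

(** If v > w, the entry v itself is counted in its own rank but not in that of w. *)
Lemma rank_mono s : {in s &, {mono rank s : v w / v <= w}}.
Proof.
move=> v w vs ws; case: (leqP v w) => vw.
  by apply: sub_count => y /= /leq_trans; apply.
(* the entries up to v split into those up to w and those between w and v *)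
have -> : rank s v = rank s w + count (fun y => w < y <= v) s.
  rewrite /rank -count_predUI.
  rewrite (eq_count (a1 := predI _ _) (a2 := pred0)) ?count_pred0 ?addn0.
    by apply: eq_count => y /=; lia.
  by move=> y /=; lia.
have : 0 < count (fun y => w < y <= v) s.
  by rewrite -has_count; apply/hasP; exists v => //=; rewrite vw leqnn.
lia.
Qed.

Lemma rank_lt s : {in s &, forall v w, (rank s v < rank s w) = (v < w)}.
Proof. by move=> v w vs ws; rewrite !ltnNge rank_mono. Qed.

Lemma rank_map (f : nat -> nat) s v :
  {in s, forall w, (f w <= f v) = (w <= v)} -> rank (map f s) (f v) = rank s v.
Proof. by move=> H; rewrite /rank count_map; apply: eq_in_count => w /H. Qed.

Lemma reduction_map (f : nat -> nat) s :
  {in s &, {mono f : v w / v <= w}} -> reduction (map f s) = reduction s.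
Proof.
move=> fmono; rewrite /reduction -map_comp; apply/eq_in_map => v vs /=.
by rewrite count_map; apply: eq_in_count => w ws /=; rewrite fmono.
Qed.

Lemma factor_map (f : nat -> nat) s i j :
  factor (map f s) i j = map f (factor s i j).
Proof. by rewrite /factor -map_take map_drop. Qed.

Lemma mem_factor s i j : {subset factor s i j <= s}.
Proof. by move=> v /mem_drop /mem_take. Qed.

Lemma size_factor s i j :
  j <= size s -> 0 < i <= j.+1 -> size (factor s i j) = j.+1 - i.
Proof. move=> js ij; rewrite size_drop size_take_min; lia. Qed.

(** Reducing is applying the monotone map [rank s], which reductions of factors
    do not see. *)
Lemma reduction_factor s i j :
  reduction (factor (reduction s) i j) = reduction (factor s i j).
Proof.
rewrite [reduction s]/reduction factor_map; apply: reduction_map.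
move=> v w /mem_factor vs /mem_factor ws; exact: rank_mono.
Qed.

Lemma size_reduction s : size (reduction s) = size s.
Proof. exact: size_map. Qed.

Lemma factor_take s i j j' : j <= j' -> factor (take j' s) i j = factor s i j.
Proof. by move=> jj'; rewrite /factor take_takel. Qed.

Lemma factor_factor s i j a b : 0 < i -> 0 < a -> i.-1 + b <= j ->
  factor (factor s i j) a b = factor s (i.-1 + a) (i.-1 + b).
Proof.
move=> i0 a0 bj; rewrite /factor take_drop take_takel; last lia.
by rewrite drop_drop; congr (drop _ (take _ _)); lia.
Qed.

(** How nested intervals of a cluster would violate the absence of redundancies. *)
Lemma contains_reduction_factor s u v : 0 < u.1 <= v.1 -> v.1 <= v.2 <= u.2 ->
    u.2 <= size s ->
  contains (reduction (factor s u.1 u.2)) (reduction (factor s v.1 v.2)).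
Proof.
move=> uv vu us; exists (v.1 - u.1.-1).
rewrite !size_reduction !size_factor; try lia.
split; [lia | lia |].
by rewrite reduction_factor factor_factor; first congr reduction;
   first congr factor; lia.
Qed.

Lemma mem_takeP o p v : reflect (exists2 i, i < minn o (size p) & v = nth 0 p i)
  (v \in take o p).
Proof.
apply: (iffP (nthP 0)) => -[i].
  by rewrite size_take_min => io <-; exists i; rewrite ?nth_take //; lia.
by move=> io ->; exists i; rewrite ?size_take_min ?nth_take //; lia.
Qed.

Lemma perm_iota_range k s v : perm_eq s (iota 1 k) -> (v \in s) = (0 < v <= k).
Proof. by move=> /perm_mem ->; rewrite mem_iota add1n ltnS. Qed.

Lemma perm_iota_uniq k s : perm_eq s (iota 1 k) -> uniq s.
Proof. by move=> /perm_uniq ->; exact: iota_uniq. Qed.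

Lemma perm_iota_size k s : perm_eq s (iota 1 k) -> size s = k.
Proof. by move=> /perm_size ->; rewrite size_iota. Qed.

Lemma rank_iota k v : v <= k -> rank (iota 1 k) v = v.
Proof.
move=> vk; rewrite /rank -size_filter -[k](subnKC vk) iotaD filter_cat.
rewrite (_ : [seq y <- iota 1 v | _] = iota 1 v); last first.
  by apply/all_filterP/allP => y; rewrite mem_iota; lia.
rewrite (_ : [seq y <- _ | _] = [::]) ?cats0 ?size_iota //.
apply/eqP; rewrite -(negbK (_ == _)) -has_filter -all_predC.
by apply/allP => y; rewrite mem_iota /=; lia.
Qed.

Lemma rank_perm k s v : perm_eq s (iota 1 k) -> v <= k -> rank s v = v.
Proof. by move=> /permP sk vk; rewrite /rank sk; exact: rank_iota. Qed.

Lemma reduction_perm k s : perm_eq s (iota 1 k) -> reduction s = s.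
Proof.
move=> sk; rewrite -[RHS]map_id; apply/eq_in_map => v.
by rewrite (perm_iota_range _ sk) => /andP[_]; exact: rank_perm sk.
Qed.

(** Ranks are distinct and lie between 1 and [size s], so they fill this range. *)
Lemma perm_reduction s : uniq s -> perm_eq (reduction s) (iota 1 (size s)).
Proof.
move=> us; have ur : uniq (reduction s).
  rewrite map_inj_in_uniq // => v w vs ws eq_vw.
  have rm := @rank_mono s.
  have e1 := rm v w vs ws; have e2 := rm w v ws vs.
  rewrite /rank in e1 e2; lia.
apply: uniq_perm => //; first exact: iota_uniq.
have sub : {subset reduction s <= iota 1 (size s)}.
  move=> _ /mapP[v vs ->]; rewrite mem_iota add1n ltnS count_size andbT.
  by rewrite -has_count; apply/hasP; exists v => /=.
by case: (uniq_min_size ur sub); rewrite ?size_iota ?size_reduction.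
Qed.

(** The inverse of reduction once the set of values U, listed increasingly, is
    known: the letter a, counted from 1, becomes the a-th element of U. *)
Definition relabel U s := [seq nth 0 U a.-1 | a <- s].

Lemma index_rank U v : sorted ltn U -> v \in U -> (rank U v).-1 = index v U.
Proof.
elim: U => // u U IH /= pU; rewrite inE /rank /= => /orP[/eqP->|vU].
  rewrite leqnn eqxx /=; apply/eqP.
  rewrite -[_ == _]negbK -lt0n -has_count; apply/hasPn => y yU.
  by move/(order_path_min ltn_trans)/allP/(_ y yU): pU; rewrite /= ltnNge.
have uv := allP (order_path_min ltn_trans pU) v vU.
rewrite /= (ltnW uv) (ltn_eqF uv) add1n /= -IH ?(path_sorted pU) //.
by rewrite prednK // -has_count; apply/hasP; exists v => /=.
Qed.

Lemma nth_rank U v : sorted ltn U -> v \in U -> nth 0 U (rank U v).-1 = v.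
Proof. by move=> sU vU; rewrite index_rank // nth_index. Qed.

Lemma relabel_reduction U s :
  sorted ltn U -> perm_eq U s -> relabel U (reduction s) = s.
Proof.
move=> sU Us; rewrite /relabel -map_comp -[RHS]map_id; apply/eq_in_map => v vs.
by rewrite /= -(permP Us) nth_rank // (perm_mem Us).
Qed.

Lemma relabel_mono U s k : sorted ltn U -> size U = k -> perm_eq s (iota 1 k) ->
  {in s &, {mono (fun a => nth 0 U a.-1) : v w / v <= w}}.
Proof.
move=> sU Uk sk v w; rewrite !(perm_iota_range _ sk) => vk wk.
have lt_nth := sorted_ltn_nth ltn_trans 0 sU.
case: (ltngtP v w) => [vw|wv|->]; last by rewrite leqnn.
  by apply/ltnW/lt_nth; rewrite ?inE; lia.
by apply/negbTE; rewrite -ltnNge; apply: lt_nth; rewrite ?inE; lia.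
Qed.

Lemma reduction_relabel U s k : sorted ltn U -> size U = k ->
  perm_eq s (iota 1 k) -> reduction (relabel U s) = s.
Proof.
move=> sU Uk sk; rewrite reduction_map; first exact: reduction_perm sk.
exact: relabel_mono sk.
Qed.

Lemma perm_relabel U s : perm_eq s (iota 1 (size U)) -> perm_eq (relabel U s) U.
Proof.
move=> sU; apply: (perm_trans (perm_map _ sU)).
have -> : [seq nth 0 U a.-1 | a <- iota 1 (size U)] = U; last by [].
by rewrite (iotaDl 1 0) -map_comp map_nth_iota0 // take_size.
Qed.

End Words.

(** * Tails of clusters, and the last interval *)

Section Clusters.
Local Open Scope nat_scope.
Variable (B : set (seq nat)).
Implicit Types (p q x : seq nat) (c : seq nat * seq (nat * nat)).

Definition last_interval c := last (0, 0) c.2.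

Definition tail_word c := factor c.1 (last_interval c).1 (last_interval c).2.

Definition tail_values c := sort leq (tail_word c).

Definition clusters_ending k p : set (seq nat * seq (nat * nat)) :=
  [set c | cluster B k c /\ reduction (tail_word c) = p].

Lemma cluster_interval k c : cluster B k c ->
  {in c.2, forall u, 0 < u.1 <= u.2 /\ u.2 <= k}.
Proof.
case: c => pi w [_ [hw _ sw] wk _] /= u uw.
have /andP[-> ->] := wk _ uw; split=> //; rewrite andbT.
case: w hw sw wk uw => [//|u0 w] /= u0E pw _.
rewrite inE => /orP[/eqP->|uw]; first by rewrite u0E.
have /allP/(_ u uw) : all (fun v : nat * nat => u0.1 < v.1) w.
  apply: (order_path_min (leT := fun u v : nat * nat => u.1 < v.1)).
    by move=> a b d; exact: ltn_trans.
  by apply: sub_path pw => a b /andP[].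
by rewrite u0E => /ltnW.
Qed.

Lemma cluster_last k c : cluster B k c ->
  last_interval c \in c.2 /\ (last_interval c).2 = k.
Proof.
case: c => pi [|u w] [_ [//= h l _] _ _]; split=> //.
by rewrite /last_interval /= mem_last.
Qed.

Lemma cluster_size k c : cluster B k c -> size c.1 = k.
Proof. by case: c => pi w [pk _ _ _]; exact: perm_iota_size pk. Qed.

Lemma cluster_uniq k c : cluster B k c -> uniq c.1.
Proof. by case: c => pi w [pk _ _ _]; exact: perm_iota_uniq pk. Qed.

Lemma clusters_ending_size k p c : clusters_ending k p c ->
  0 < size p <= k /\ last_interval c = ((k - size p).+1, k).
Proof.
move=> [Hc <-]; have [lw lk] := cluster_last Hc.
have [h _] := cluster_interval Hc lw; rewrite lk in h.
have -> : size (reduction (tail_word c)) = k.+1 - (last_interval c).1.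
  by rewrite size_reduction size_factor ?lk ?(cluster_size Hc) //; lia.
by move: lk h; case: last_interval => i j /= -> h; split; [|congr pair]; lia.
Qed.

(** The interval of the last pattern ends at k, so the factor it cuts out is a
    suffix of the permutation. *)
Lemma tail_wordE k p c : clusters_ending k p c ->
  tail_word c = drop (k - size p) c.1.
Proof.
move=> Hc; have [sp lE] := clusters_ending_size Hc.
by rewrite /tail_word lE /factor /= take_oversize // (cluster_size Hc.1).
Qed.

Lemma tail_word_uniq k c : cluster B k c -> uniq (tail_word c).
Proof. by move=> /cluster_uniq uc; rewrite /tail_word /factor drop_uniq ?take_uniq. Qed.

Lemma size_tail_word k p c : clusters_ending k p c -> size (tail_word c) = size p.
Proof. by move=> [_ <-]; rewrite size_reduction. Qed.

Lemma sort_uniq_sorted s : uniq s -> sorted ltn (sort leq s).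
Proof.
by move=> us; rewrite ltn_sorted_uniq_leq sort_uniq us sort_sorted //; exact: leq_total.
Qed.

Lemma tail_values_sorted k c : cluster B k c -> sorted ltn (tail_values c).
Proof. by move=> /tail_word_uniq; exact: sort_uniq_sorted. Qed.

Lemma relabel_tail k p c :
  clusters_ending k p c -> relabel (tail_values c) p = tail_word c.
Proof.
move=> [Hc <-]; apply: relabel_reduction; first exact: tail_values_sorted Hc.
by rewrite perm_sort.
Qed.

Lemma tail_values_path k p c : clusters_ending k p c ->
  path ltn 0 (rcons (tail_values c) k.+1).
Proof.
move=> [Hc _]; have sv := tail_values_sorted Hc.
have inr v : v \in tail_values c -> 0 < v <= k.
  rewrite mem_sort => /mem_factor; case: c Hc {sv} => pi w [pk _ _ _] /=.
  by rewrite (perm_iota_range _ pk).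
rewrite rcons_path path_sortedE ?sv ?andbT; last exact: ltn_trans.
apply/andP; split; first by apply/allP => v /inr /andP[].
case E : (tail_values c) => [//|a s] /=.
by have /inr/andP[] : last a s \in tail_values c by rewrite E mem_last.
Qed.

Lemma size_tail_values k p c : clusters_ending k p c -> size (tail_values c) = size p.
Proof. by move=> /size_tail_word <-; rewrite size_sort. Qed.

Lemma finite_clusters_ending k p : finite_set (clusters_ending k p).
Proof.
pose T := (size p).-tuple 'I_k.+1.
apply: (@sub_finite_set _ _
  (\bigcup_(t in [set: T]) clusters_with_tail B k p (map val t))%classic).
  move=> c Hc; have uv : size (map (@inord k) (tail_values c)) == size p.
    by rewrite size_map (size_tail_values Hc).
  exists (Tuple uv) => //; split; [exact: Hc.1 | exact: Hc.2 |].
  rewrite -(tail_wordE Hc) /= -map_comp.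
  have -> : map (val \o @inord k) (tail_values c) = tail_values c.
    rewrite -[RHS]map_id; apply/eq_in_map => v; rewrite mem_sort => /mem_factor.
    case: c Hc {uv} => pi w [[pk _ _ _] _] /=.
    by rewrite (perm_iota_range _ pk) => /andP[_ vk] /=; rewrite inordK.
  by rewrite perm_sym perm_sort.
apply: bigcup_finite => [|t _]; [exact: finite_finset|].
exact: finite_clusters_with_tail.
Qed.

Hypothesis hB : pattern_set B.

(** Otherwise an interval would lie inside its predecessor, and the pattern of
    the predecessor would contain a pattern of smaller length. *)
Lemma cluster_ends_increase k c : cluster B k c ->
  sorted (fun u v : nat * nat => u.2 < v.2) c.2.
Proof.
move=> Hc; have wP := cluster_interval Hc; have sz := cluster_size Hc.
case: c Hc wP sz => pi w [_ [_ _ sw] _ wB] /= wP sz.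
have : {in w &, forall u v : nat * nat, (u.1 < v.1 <= u.2) -> u.2 < v.2}.
  move=> u v uw vw /= uv; rewrite ltnNge; apply/negP => vu.
  have [[u1 uk] [v1 vk]] := (wP u uw, wP v vw).
  apply: hB.2 (wB _ uw) (wB _ vw) _ (contains_reduction_factor _ _ _).
  - by move/(congr1 size); rewrite !size_reduction !size_factor; lia.
  - lia.
  - lia.
  - lia.
by move=> H; apply: (sub_in_sorted H _ sw); apply/allP.
Qed.

Definition parent_intervals c := take (size c.2).-1 c.2.
Definition parent_last c := last (0, 0) (parent_intervals c).
Definition parent c :=
  (reduction (take (parent_last c).2 c.1), parent_intervals c).
Definition parent_pattern c :=
  reduction (factor c.1 (parent_last c).1 (parent_last c).2).
Definition overlap k p c := (parent_last c).2 - (k - size p).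

(** The rank in q, counted from 1, of the entry of the parent that becomes the
    entry v of p: the last o places of the parent are the first o of the last
    interval. *)
Definition source p q o (v : nat) := nth 0 q (size q - o + index v p).

(** The first o entries of p and the last o entries of q have the same relative
    order.  The condition [o < size q] makes the last interval start after the
    interval of q. *)
Definition compatible p q o :=
  [&& 0 < o, o < size p, o < size q &
      all (fun v => all (fun w => (v < w) ==> (source p q o v < source p q o w))
        (take o p)) (take o p)].

(** The value of the entry v of p in the extension: its value in the parent,
    where y lists the tail values, plus the number of new values below it.  The
    slot [(size p).+1] stands for the upper bound k + 1 of all values, which
    plays the part of one more prescribed value. *)
Definition forced_value k p q o (y : seq nat) (v : nat) :=
  if v == (size p).+1 then k.+1
  else nth 0 y (source p q o v).-1 + rank (drop o p) v.

(** For compatible p and q, the increasing sequences x that occur as tail values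
    of an extension of the cluster c' of pattern q. *)
Definition valid_tail k p q o c' x :=
  [/\ size x = size p, path ltn 0 (rcons x k.+1) &
      {in take o p, forall v,
         nth 0 x v.-1 = forced_value k p q o (tail_values c') v}].

(** A single interval would be [1, k] and force [size p = k]; so for
    [size p < k] the last interval has a predecessor. *)
Lemma parent_spec k p c : clusters_ending k p c -> size p < k ->
  [/\ c.2 = rcons (parent_intervals c) ((k - size p).+1, k),
      parent_last c \in parent_intervals c,
      0 < (parent_last c).1 <= k - size p,
      k - size p < (parent_last c).2 < k &
      {in parent_intervals c, forall u, u.2 <= (parent_last c).2}].
Proof.
move=> Hc pk; have [sp lE] := clusters_ending_size Hc.
have inc := cluster_ends_increase Hc.1.
have wP := cluster_interval Hc.1.
rewrite /parent_last /parent_intervals.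
case: c Hc lE inc wP => pi w; rewrite /last_interval /= => -[[_ [hw _ sw] _ _] _].
case/lastP: w hw sw => [//|w u]; rewrite last_rcons size_rcons /= => hw sw uE inc wP.
rewrite -cats1 take_size_cat // cats1 uE.
have lw : last (0, 0) w \in w.
  case: w hw {sw inc wP} => [|u0 w] /=; last by rewrite mem_last.
  by rewrite uE /=; lia.
have [/andP[l1 l2] lk] : 0 < (last (0, 0) w).1 <= (last (0, 0) w).2
  /\ (last (0, 0) w).2 <= k by apply: wP; rewrite mem_rcons inE lw orbT.
move: sw inc {wP}; rewrite uE.
case: w lw l1 l2 lk {hw} => [//|u0 w] /= lw l1 l2 lk.
rewrite !rcons_path /= => /andP[_ /andP[a1 a2]] /andP[pw a3].
split=> //; try lia.
have tr : transitive (fun u v : nat * nat => u.2 < v.2).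
  by move=> a b d; exact: ltn_trans.
have : pairwise (fun u v : nat * nat => u.2 < v.2) (u0 :: w).
  by rewrite -sorted_pairwise.
rewrite lastI pairwise_rcons => /andP[/allP wl _] v.
rewrite mem_rcons inE => /orP[/eqP-> //|/wl /=].
exact: ltnW.
Qed.
End Clusters.

(** * Clusters and their parents *)

Section Parents.
Local Open Scope nat_scope.
Variable (B : set (seq nat)).
Implicit Types (p q x : seq nat) (c : seq nat * seq (nat * nat)).
Hypothesis hB : pattern_set B.
Lemma cluster_perm k c : cluster B k c -> perm_eq c.1 (iota 1 k).
Proof. by case: c => pi w []. Qed.

Lemma parent_overlap k p c : clusters_ending B k p c -> size p < k ->
  (parent_last c).2 = k - size p + overlap k p c.
Proof. by move=> Hc pk; rewrite /overlap; case: (parent_spec hB Hc pk); lia. Qed.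

Lemma tail_word_parent c :
  tail_word (parent c) =
  factor (reduction (take (parent_last c).2 c.1))
    (parent_last c).1 (parent_last c).2.
Proof. by []. Qed.

Lemma parent_ending k p c : clusters_ending B k p c -> size p < k ->
  clusters_ending B (k - size p + overlap k p c) (parent_pattern c) (parent c).
Proof.
move=> Hc pk; rewrite -parent_overlap //.
have [wE lw l1 l2 wle] := parent_spec hB Hc pk.
have sz := cluster_size Hc.1.
have wP := cluster_interval Hc.1.
have uc := cluster_uniq Hc.1.
split; last first.
  by rewrite tail_word_parent reduction_factor factor_take.
rewrite /parent; set j := (parent_last c).2 in l2 wle *.
have szj : size (take j c.1) = j by rewrite size_takel // sz; lia.
case: Hc wE => + _; case: c lw l1 sz wP uc @j l2 wle szj => pi w.
move=> lw l1 sz wP uc j l2 wle szj [_ [hw _ sw] _ wB] /= wE.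
set w' := parent_intervals _ in lw wle wE *.
have w'w u : u \in w' -> u \in w by rewrite wE mem_rcons inE => ->; rewrite orbT.
split.
- by rewrite -[X in iota 1 X]szj perm_reduction // take_uniq.
- split; last by rewrite take_sorted.
  + by move: lw hw; rewrite wE; move: (parent_last _) => u; case: (w').
  + by [].
- by move=> u uw; have [/andP[_ ->] _] := wP u (w'w _ uw); rewrite /= wle.
- move=> u uw; rewrite reduction_factor factor_take ?wle //.
  exact/wB/w'w.
Qed.

Lemma parent_pattern_in k p c : clusters_ending B k p c -> size p < k ->
  B (parent_pattern c).
Proof.
move=> Hc pk; have [wE lw _ _ _] := parent_spec hB Hc pk.
case: c Hc wE lw => pi w [[_ _ _ wB] _] /= wE lw.
apply: (wB (parent_last (pi, w))).
by rewrite [X in _ \in X]wE mem_rcons inE lw orbT.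
Qed.

Lemma size_parent_pattern k p c : clusters_ending B k p c -> size p < k ->
  size (parent_pattern c) = (k - size p + overlap k p c).+1 - (parent_last c).1.
Proof.
move=> Hc pk; have [_ _ l1 l2 _] := parent_spec hB Hc pk.
rewrite -parent_overlap // size_reduction size_factor // ?(cluster_size Hc.1); lia.
Qed.

Lemma overlap_bounds k p c : clusters_ending B k p c -> size p < k ->
  [/\ 0 < overlap k p c, overlap k p c < size p &
      overlap k p c < size (parent_pattern c)].
Proof.
move=> Hc pk; have [_ _ l1 l2 _] := parent_spec hB Hc pk.
have [sp _] := clusters_ending_size Hc.
by rewrite (size_parent_pattern Hc pk) /overlap; split; lia.
Qed.

Lemma nth_tail_values k p c i : clusters_ending B k p c -> i < size p ->
  nth 0 (tail_values c) (nth 0 p i).-1 = nth 0 c.1 (k - size p + i).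
Proof.
move=> Hc ip; rewrite -nth_drop -(tail_wordE Hc) -(relabel_tail Hc).
by rewrite (nth_map 0).
Qed.

(** The i-th entry of the last interval is also an entry of the preceding one,
    at position [size q - o + i]. *)
Lemma nth_parent_pattern k p c i : clusters_ending B k p c -> size p < k ->
    let q := parent_pattern c in let o := overlap k p c in i < o ->
  nth 0 q (size q - o + i) =
  rank (factor c.1 (parent_last c).1 (parent_last c).2)
    (nth 0 c.1 (k - size p + i)) /\
  nth 0 c.1 (k - size p + i) \in
    factor c.1 (parent_last c).1 (parent_last c).2.
Proof.
move=> Hc pk q o io; have [_ o1 o2] := overlap_bounds Hc pk.
have [_ _ l1 l2 _] := parent_spec hB Hc pk.
have szq := size_parent_pattern Hc pk.
have jE := parent_overlap Hc pk.
have szf : size (factor c.1 (parent_last c).1 (parent_last c).2) = size q.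
  by rewrite -size_reduction.
have ltf : size q - o + i <
    size (factor c.1 (parent_last c).1 (parent_last c).2).
  by rewrite szf /q /o; move: io o2; rewrite /o; lia.
have -> : nth 0 c.1 (k - size p + i) =
    nth 0 (factor c.1 (parent_last c).1 (parent_last c).2) (size q - o + i).
  rewrite /factor nth_drop nth_take; first congr nth;
  by move: szq io o2; rewrite -/q -/o; lia.
by rewrite mem_nth // (nth_map 0).
Qed.

Lemma is_perm_ending k p c : clusters_ending B k p c -> perm_eq p (iota 1 (size p)).
Proof.
move=> Hc; rewrite -Hc.2 size_reduction perm_reduction //.
exact: tail_word_uniq Hc.1.
Qed.

Lemma ending_uniq k p c : clusters_ending B k p c -> uniq p.
Proof. by move=> /is_perm_ending; exact: perm_iota_uniq. Qed.

Lemma parent_compatible k p c : clusters_ending B k p c -> size p < k ->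
  compatible p (parent_pattern c) (overlap k p c).
Proof.
move=> Hc pk; have [o0 o1 o2] := overlap_bounds Hc pk.
have up := ending_uniq Hc.
rewrite /compatible o0 o1 o2 /=.
apply/allP => _ /mem_takeP[i io ->]; apply/allP => _ /mem_takeP[j jo ->].
move: io jo; rewrite !leq_min => /andP[io ip] /andP[jo jp].
rewrite /source !index_uniq //.
have [-> mi] := nth_parent_pattern Hc pk io.
have [-> mj] := nth_parent_pattern Hc pk jo.
rewrite rank_lt //; apply/implyP.
have pk' := is_perm_ending Hc.
have rp l : l < size p -> 0 < nth 0 p l <= size p.
  by move=> lp; rewrite -(perm_iota_range _ pk') mem_nth.
have lt_nth := sorted_ltn_nth ltn_trans 0 (tail_values_sorted Hc.1).
move=> lt_ij; rewrite -!(nth_tail_values Hc) //.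
by apply: lt_nth; rewrite ?inE ?(size_tail_values Hc);
   have := rp _ ip; have := rp _ jp; lia.
Qed.

Lemma drop_parent k p c : clusters_ending B k p c -> size p < k ->
  drop (parent_last c).2 c.1 = relabel (tail_values c) (drop (overlap k p c) p).
Proof.
move=> Hc pk; rewrite /relabel map_drop -/(relabel _ p) (relabel_tail Hc).
by rewrite (tail_wordE Hc) drop_drop (parent_overlap Hc pk) addnC.
Qed.

(** The rank of v in a permutation of 1, ..., k is v.  Splitting it over the part
    covered by the parent and the new entries gives the parent's value plus the
    number of new values below v. *)
Lemma parent_valid k p c : clusters_ending B k p c -> size p < k ->
  valid_tail k p (parent_pattern c) (overlap k p c) (parent c) (tail_values c).
Proof.
move=> Hc pk; have [o0 o1 o2] := overlap_bounds Hc pk.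
have up := ending_uniq Hc; have pp := is_perm_ending Hc.
split; [exact: size_tail_values Hc | exact: tail_values_path Hc|].
move=> _ /mem_takeP[i + ->]; rewrite leq_min => /andP[io ip].
have [_ _ l1 l2 _] := parent_spec hB Hc pk.
have rp : 0 < nth 0 p i <= size p.
  by rewrite -(perm_iota_range _ pp) mem_nth.
rewrite /forced_value ifN; last by lia.
have Hc' := parent_ending Hc pk.
rewrite /source index_uniq //.
rewrite (nth_tail_values Hc') /=; last lia.
set q := parent_pattern c; set o := overlap k p c.
have -> : k - size p + o - size q + (size q - o + i) = k - size p + i.
  have := size_parent_pattern Hc pk; rewrite -/q -/o; move: o2 o1; rewrite -/o -/q; lia.
set j := (parent_last c).2.
have jE : j = k - size p + o := parent_overlap Hc pk.
have sz := cluster_size Hc.1.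
rewrite (nth_map 0) ?size_takel ?sz; try lia.
rewrite nth_take; last lia.
rewrite -(nth_tail_values Hc) //; set v := nth 0 (tail_values c) _.
have <- : rank (drop j c.1) v = rank (drop o p) (nth 0 p i).
  rewrite (drop_parent Hc pk) rank_map // => w /mem_drop wp.
  by rewrite (relabel_mono (tail_values_sorted Hc.1) (size_tail_values Hc) pp) ?mem_nth.
rewrite /rank -count_cat cat_take_drop -/(rank _ _).
rewrite (rank_perm (cluster_perm Hc.1)) //.
have : v \in c.1 by rewrite /v (nth_tail_values Hc) // mem_nth // sz; lia.
by rewrite (perm_iota_range _ (cluster_perm Hc.1)) => /andP[].
Qed.

Definition new_values p o x := relabel x (drop o p).

Definition old_values k p o x : seq nat :=
  [seq v <- iota 1 k | v \notin new_values p o x].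

Definition extend k p o c x :=
  (relabel (old_values k p o x) c.1 ++ new_values p o x,
   rcons c.2 ((k - size p).+1, k)).

(** The new values are read off from the tail, the old values are the remaining
    ones, and [relabel] undoes the reduction made in [parent]. *)
Lemma extend_parent k p c : clusters_ending B k p c -> size p < k ->
  extend k p (overlap k p c) (parent c) (tail_values c) = c.
Proof.
move=> Hc pk; rewrite /extend /old_values /new_values -(drop_parent Hc pk).
have [wE _ _ _ _] := parent_spec hB Hc pk.
rewrite -wE relabel_reduction; first by rewrite cat_take_drop; case: c {Hc wE}.
  by rewrite sorted_filter ?iota_ltn_sorted //; exact: ltn_trans.
have uc := cluster_uniq Hc.1.
apply: uniq_perm; rewrite ?filter_uniq ?iota_uniq ?take_uniq // => v.
rewrite mem_filter -(perm_mem (cluster_perm Hc.1)).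
move: uc; rewrite -{1 3}(cat_take_drop (parent_last c).2 c.1) cat_uniq mem_cat.
move=> /and3P[_ /hasPn h _]; case: (boolP (v \in drop _ _)) => [/h /negbTE ->//|_].
by rewrite orbF.
Qed.

Section Extend.
Variables (k o : nat) (p q x : seq nat) (c : seq nat * seq (nat * nat)).
Hypotheses (pk : size p < k) (hp : B p).
Hypothesis (Hc : clusters_ending B (k - size p + o) q c).
Hypothesis (hcomp : compatible p q o).
Hypothesis (hx : valid_tail k p q o c x).

Let pp : perm_eq p (iota 1 (size p)) := hB.1 p hp.
Let U := old_values k p o x.
Let V := new_values p o x.

Let sx : size x = size p. Proof. by case: hx. Qed.

Let o_bounds : [/\ 0 < o, o < size p & o < size q].
Proof. by case/and4P: hcomp. Qed.

Let k_bounds : (k - size p < k) && (k - size p + o <= k).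
Proof. by case: o_bounds; lia. Qed.

Let xsorted : sorted ltn x.
Proof. by case: hx => _; rewrite rcons_path => /andP[/path_sorted]. Qed.

Let x_range v : v \in x -> 0 < v <= k.
Proof.
case: hx => _ px _ vx.
have : all (ltn 0) x /\ all (ltn^~ k.+1) x.
  have : sorted ltn (0 :: rcons x k.+1) by [].
  rewrite sorted_pairwise; last exact: ltn_trans.
  by rewrite /= pairwise_rcons all_rcons => /andP[/andP[_ ->] /andP[-> _]].
by case=> /allP/(_ v vx) /= -> /allP/(_ v vx).
Qed.

Let xp_perm : perm_eq (relabel x p) x.
Proof. by apply: perm_relabel; rewrite sx. Qed.

Let xp_uniq : uniq (relabel x p).
Proof. by rewrite (perm_uniq xp_perm) (sorted_uniq ltn_trans ltnn). Qed.

Let VE : V = drop o (relabel x p).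
Proof. by rewrite /V /new_values /relabel map_drop. Qed.

Let V_range v : v \in V -> 0 < v <= k.
Proof. by rewrite VE => /mem_drop; rewrite (perm_mem xp_perm) => /x_range. Qed.

Let usorted : sorted ltn U.
Proof. by rewrite sorted_filter ?iota_ltn_sorted //; exact: ltn_trans. Qed.

Let perm_UV : perm_eq (U ++ V) (iota 1 k).
Proof.
rewrite perm_catC perm_sym -(perm_filterC (mem V)) perm_cat2r.
apply: uniq_perm; rewrite ?filter_uniq ?iota_uniq //.
  by rewrite VE drop_uniq.
move=> v; rewrite mem_filter mem_iota add1n ltnS /=.
by case vV : (v \in V) => //=; exact: V_range.
Qed.

Let size_U : size U = k - size p + o.
Proof.
have := perm_iota_size perm_UV; rewrite size_cat VE size_drop size_map.
case: o_bounds; lia.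
Qed.

Let mono_U : {in c.1 &, {mono (fun a => nth 0 U a.-1) : v w / v <= w}}.
Proof. exact: relabel_mono usorted size_U (cluster_perm Hc.1). Qed.

Let sizeUc : size (relabel U c.1) = k - size p + o.
Proof. by rewrite size_map (cluster_size Hc.1). Qed.

(** The equations on x in [valid_tail] say exactly that relabelling the parent
    puts into the overlap the entries which p asks for there. *)
Lemma drop_relabel_old : drop (k - size p) (relabel U c.1) = relabel x (take o p).
Proof.
have [o0 o1 o2] := o_bounds.
have szt : size (take o p) = o by rewrite size_takel //; lia.
apply: (@eq_from_nth _ 0); first by rewrite size_drop sizeUc size_map szt; lia.
move=> i; rewrite size_drop sizeUc => iss; have io : i < o by lia.
have ip : i < size p by lia.
rewrite nth_drop (nth_map 0) ?(cluster_size Hc.1); last lia.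
rewrite (nth_map 0) ?szt // nth_take //.
case: hx => _ _ /(_ (nth 0 p i)).
rewrite (_ : _ \in _); last first.
  by apply/mem_takeP; exists i => //; rewrite leq_min io.
move=> /(_ isT); have rp : 0 < nth 0 p i <= size p.
  by rewrite -(perm_iota_range _ pp) mem_nth.
rewrite /forced_value ifN; last by lia.
rewrite /source index_uniq ?(perm_iota_uniq pp) //.
rewrite (nth_tail_values Hc); last lia.
have -> : k - size p + o - size q + (size q - o + i) = k - size p + i.
  have [+ _] := clusters_ending_size Hc; lia.
set v := nth 0 x _; set a := nth 0 c.1 _.
have vE : v = nth 0 (relabel x p) i by rewrite (nth_map 0).
have vx : v \in x by rewrite -(perm_mem xp_perm) vE mem_nth ?size_map.
(* v is the entry of relabel x p at a position inside the overlap, and V is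
   the part of this duplicate-free word after the overlap *)
have vV : v \notin V.
  rewrite VE vE; move: xp_uniq; rewrite -{1}(cat_take_drop o (relabel x p)).
  rewrite cat_uniq => /and3P[_ /hasPn h _].
  apply: contraL io => /h /=; rewrite -leqNgt => /negP io'.
  rewrite leqNgt; apply/negP => io; apply: io'.
  by rewrite -(nth_take _ io) mem_nth // size_takel // size_map; lia.
have vU : v \in U by rewrite mem_filter vV mem_iota add1n ltnS x_range.
have -> : rank (drop o p) (nth 0 p i) = rank V v.
  rewrite /V /new_values rank_map // => w /mem_drop wp.
  by rewrite (relabel_mono xsorted sx pp) ?mem_nth.
have : rank U v + rank V v = v.
  rewrite /rank -count_cat -/(rank _ _) (rank_perm perm_UV) //.
  by case/andP: (x_range vx).
move=> h1 h2; have <- : rank U v = a by apply: (@addIn (rank V v)); rewrite h1.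
by rewrite nth_rank.
Qed.

Let e := extend k p o c x.

Lemma drop_extend : drop (k - size p) e.1 = relabel x p.
Proof.
rewrite /e /extend /= drop_cat sizeUc ifT; last by case: o_bounds; lia.
by rewrite drop_relabel_old /new_values -map_cat cat_take_drop.
Qed.

Lemma perm_extend : perm_eq e.1 (iota 1 k).
Proof.
apply: perm_trans perm_UV; rewrite perm_cat2r; apply: perm_relabel.
by rewrite size_U; exact: cluster_perm Hc.1.
Qed.

Lemma parent_intervals_extend : parent_intervals e = c.2.
Proof. by rewrite /parent_intervals /e /= size_rcons -cats1 take_size_cat. Qed.

Lemma parent_last_extend : parent_last e = last_interval c.
Proof. by rewrite /parent_last parent_intervals_extend. Qed.

Lemma last_interval_extend : last_interval e = ((k - size p).+1, k).
Proof. by rewrite /last_interval last_rcons. Qed.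

Lemma overlap_extend : overlap k p e = o.
Proof.
by rewrite /overlap parent_last_extend (clusters_ending_size Hc).2 /=; lia.
Qed.

Lemma take_extend : take (k - size p + o) e.1 = relabel U c.1.
Proof. by rewrite take_size_cat. Qed.

Lemma parent_extend : parent e = c.
Proof.
rewrite /parent parent_intervals_extend parent_last_extend.
rewrite (clusters_ending_size Hc).2 /= take_extend.
rewrite (reduction_relabel usorted size_U (cluster_perm Hc.1)).
by case: (c).
Qed.

Lemma tail_word_extend : tail_word e = relabel x p.
Proof.
rewrite /tail_word last_interval_extend /factor take_oversize ?drop_extend //.
by rewrite (perm_iota_size perm_extend).
Qed.

Lemma tail_values_extend : tail_values e = x.
Proof.
rewrite /tail_values tail_word_extend.
rewrite (perm_sortP leq_total leq_trans anti_leq _ _ xp_perm).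
by apply: sorted_sort; [exact: leq_trans|exact: (sub_sorted ltnW)].
Qed.

Lemma factor_extend i j : j <= k - size p + o ->
  reduction (factor e.1 i j) = reduction (factor c.1 i j).
Proof.
move=> jk; rewrite -(factor_take _ _ jk) take_extend factor_map.
by apply: reduction_map => v w /mem_factor vs /mem_factor ws; exact: mono_U.
Qed.

Lemma parent_pattern_extend : parent_pattern e = q.
Proof.
rewrite /parent_pattern parent_last_extend factor_extend; first exact: Hc.2.
by rewrite (clusters_ending_size Hc).2.
Qed.

Lemma extend_ending : clusters_ending B k p e.
Proof.
have redp := reduction_relabel xsorted sx pp.
have [o0 o1 o2] := o_bounds.
have wP := cluster_interval Hc.1.
have [sq lE] := clusters_ending_size Hc.
split; last by rewrite tail_word_extend.
have tE := tail_word_extend; have lastE := last_interval_extend.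
have fE := factor_extend.
have pE := perm_extend.
rewrite /e /extend in tE lastE fE pE *.
move: Hc.1 lE wP fE tE lastE pE.
case: (c) => pi w [_ [hw lw sw] wk wB] lE wP fE tE lastE pE.
rewrite /last_interval /= in lE.
split=> //.
- split; [|by rewrite last_rcons|].
  + by rewrite /=; case: (w) hw.
  + rewrite /=; case: (w) hw sw lE => [//|u w'] /= _ sw lE.
    by rewrite rcons_path sw lE /=; lia.
- move=> u; rewrite mem_rcons inE => /orP[/eqP->|/wk/andP[-> uk]] /=.
    by rewrite leqnn andbT; case/andP: k_bounds.
  by apply: leq_trans uk _; case/andP: k_bounds.
- move=> u; rewrite mem_rcons inE => /orP[/eqP->|uw].
    by move: tE; rewrite /tail_word lastE => ->; rewrite redp.
  by rewrite fE; [exact: wB | case/andP: (wk _ uw)].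
Qed.
End Extend.
End Parents.

(** * Increasing sequences with prescribed values *)

Section Fillings.
Local Open Scope nat_scope.
Variables (fixed : pred nat) (e : nat -> nat) (top : nat).

(** Positions are named by the letters of s.  A position d with [fixed d] must
    receive the value [e d]; the values increase strictly, above a and below
    [e top]. *)
Fixpoint fillings a (s : seq nat) : seq (seq nat) :=
  match s with
  | [::] => if a < e top then [:: [::]] else [::]
  | d :: s' =>
      if fixed d then
        if a < e d then [seq e d :: x | x <- fillings (e d) s'] else [::]
      else [seq v :: x | v <- index_iota a.+1 (e top), x <- fillings v s']
  end.

Definition next_fixed s := head top (filter fixed s).

Lemma mem_fillings a s x : (x \in fillings a s) =
  [&& size x == size s, path ltn a (rcons x (e top)) &
      all (fun dv => fixed dv.1 ==> (dv.2 == e dv.1)) (zip s x)].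
Proof.
elim: s a x => [|d s IH] a x /=.
  by case: ifP => ae; case: x => [|v x] //=; rewrite ?ae.
case: ifP => fd.
  case: ifP => ae.
    apply/mapP/idP => [[y + ->] /=|].
      by rewrite IH eqSS fd ae eqxx.
    case: x => [//|v x] /=; rewrite fd eqSS /=.
    case/and3P => sx /andP[av px] /andP[/eqP vE ax].
    by exists x; rewrite ?vE // IH sx ax -vE px.
  case: x => [//|v x]; rewrite in_nil; apply/esym/negP => /=.
  by rewrite fd /= => /and3P[_ /andP[av _] /andP[/eqP vE _]]; rewrite -vE av in ae.
apply/allpairsPdep/idP => [[v [y [+ + ->]]] /=|].
  by rewrite mem_index_iota IH eqSS fd /= => /andP[-> _].
case: x => [//|v x] /=; rewrite fd eqSS /= => /and3P[sx /andP[av px] ax].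
exists v, x; split=> //=; last by rewrite IH sx px ax.
rewrite mem_index_iota av /=; move: px; rewrite (path_sortedE ltn_trans).
by rewrite all_rcons => /andP[/andP[]].
Qed.

Lemma uniq_fillings a s : uniq (fillings a s).
Proof.
elim: s a => [|d s IH] a /=; first by case: ifP.
case: ifP => _.
  by case: ifP => // _; rewrite map_inj_uniq ?IH // => x y [].
apply: allpairs_uniq_dep => [|v _|]; [exact: iota_uniq | exact: IH |].
by move=> [v x] [w y] _ _ /= [<- <-].
Qed.

(** In the geometric sum over a free value, the values that leave no room before
    the next prescribed one contribute nothing, so the range of summation may
    stop there. *)
Lemma fillings_nil a s : e (next_fixed s) <= a -> fillings a s = [::].
Proof.
move=> ea; apply/eqP; rewrite -size_eq0 -leqn0 leqNgt -has_predT; apply/hasP => -[x].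
move=> xs _; move: xs; suff: x \in fillings a s -> a < e (next_fixed s).
  by move=> h /h; rewrite ltnNge ea.
rewrite /next_fixed; elim: s a x {ea} => [|d s IH] a x /=; first by case: ifP.
case: ifP => fd; first by case: ifP.
case/allpairsPdep => v [y [+ /IH h _]]; rewrite mem_index_iota => /andP[av _].
exact: ltn_trans h.
Qed.

End Fillings.

(** * Iterated geometric sums *)

Section Monomials.
Variable n : nat.

Lemma ratfun_monomialD (u v : 'X_{1..n}) :
  ratfun_monomial (u + v)%MM = ratfun_monomial u * ratfun_monomial v.
Proof. by rewrite /ratfun_monomial mpolyXD tofracM. Qed.

Lemma ratfun_monomial0 : ratfun_monomial (0%MM : 'X_{1..n}) = 1.
Proof. by rewrite /ratfun_monomial mpolyX0 tofrac1. Qed.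

Lemma ratfun_monomial_sum (I : Type) (r : seq I) (P : pred I)
    (f : I -> 'X_{1..n}) :
  ratfun_monomial (\sum_(i <- r | P i) f i)%MM =
  \prod_(i <- r | P i) ratfun_monomial (f i).
Proof. exact: (big_morph _ ratfun_monomialD ratfun_monomial0). Qed.

(** The geometric sums below have a nonconstant monomial as ratio, so they can
    be divided by 1 - r. *)
Lemma ratfun_monomial_neq1 (u : 'X_{1..n}) : u != 0%MM -> 1 - ratfun_monomial u != 0.
Proof.
apply: contra_neq => /eqP; rewrite subr_eq0 -ratfun_monomial0 /ratfun_monomial.
rewrite tofrac_eq => /eqP /(congr1 (mcoeff u)).
by rewrite !mcoeffX eqxx; case: eqP => // _ /eqP; rewrite oner_eq0.
Qed.

Lemma sum_geometric (K : fieldType) (r : K) a b : (a <= b)%N -> 1 - r != 0 ->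
  \sum_(a <= i < b) r ^+ i = (r ^+ a - r ^+ b) / (1 - r).
Proof.
move=> ab r1; apply: (mulIf r1); rewrite divfK // mulr_suml -[RHS]opprB.
rewrite -(telescope_sumr (fun i => r ^+ i) ab) -sumrN; apply: eq_bigr => i _.
by rewrite opprB mulrBr mulr1 exprSr.
Qed.

Lemma geometric_terms (K : fieldType) (c r w : K) a b : 1 - r != 0 ->
  c * w * ((r ^+ a.+1 - r ^+ b) / (1 - r)) =
  c * (r / (1 - r)) * r ^+ a * w + - (c / (1 - r)) * 1 * (r ^+ b * w).
Proof. by move=> r1; rewrite exprS; field. Qed.

Variables (fixed : pred nat) (top : nat) (z : nat -> 'X_{1..n}).

(** A coefficient R, a monomial N, and a monomial for each prescribed position;
    see [term_value] for the product that they encode. *)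
Definition term := (ratfun n * 'X_{1..n} * (nat -> 'X_{1..n}))%type.

(** A prescribed position d absorbs its own variable and the monomial N that the
    later positions attach to their lower bound, which is the value at d.  A
    free position is summed geometrically with ratio r: the bound a yields
    r^(a+1) and the next prescribed value f yields r^(e f), whence two terms. *)
Fixpoint terms (s : seq nat) : seq term :=
  match s with
  | [::] => [:: (1, 0%MM, fun _ => 0%MM)]
  | d :: s' =>
      if fixed d then
        [seq (T.1.1, 0%MM, fun d' => if d' == d then z d + T.1.2 else T.2 d')%MM
           | T <- terms s']
      else flatten [seq let u := (z d + T.1.2)%MM in
        let r := ratfun_monomial u in
        [:: (T.1.1 * (r / (1 - r)), u, T.2);
            (- (T.1.1 / (1 - r)), 0%MM,
             fun d' => if d' == next_fixed fixed top s' then u + T.2 d'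
                       else T.2 d')%MM]
           | T <- terms s']
  end.

Definition term_value (e : nat -> nat) (a : nat) (s : seq nat) (T : term) :=
  T.1.1 * ratfun_monomial T.1.2 ^+ a *
  \prod_(d <- rcons (filter fixed s) top) ratfun_monomial (T.2 d) ^+ e d.

(** The geometric sum over a free value v needs the formula for the later
    positions only for v below the next prescribed value: beyond it the left
    side is an empty sum, while the closed formula need not vanish.  Between
    two prescribed values that are too close the closed formula is still right,
    as long as they increase strictly: the empty geometric sum is 0. *)
Lemma sum_fillings e a s : uniq (rcons s top) -> {in s, forall d, z d != 0%MM} ->
    path ltn a (map e (rcons (filter fixed s) top)) ->
  \sum_(x <- fillings fixed e top a s)
     \prod_(dv <- zip s x) ratfun_monomial (z dv.1) ^+ dv.2 =
  \sum_(T <- terms s) term_value e a s T.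
Proof.
elim: s a => [|d s IH] a us zs pe.
  rewrite /= in pe; rewrite /= /term_value.
  move: pe => /andP[-> _]; rewrite !big_seq1 big_nil /=.
  by rewrite !ratfun_monomial0 !expr1n !mulr1.
move: us; rewrite rcons_cons cons_uniq => /andP[ds us].
have zs' : {in s, forall d, z d != 0%MM}.
  by move=> d' d's; apply: zs; rewrite inE d's orbT.
have zd : z d != 0%MM by apply: zs; rewrite mem_head.
have dF : d \notin rcons (filter fixed s) top.
  by apply: contra ds; rewrite !mem_rcons !inE mem_filter; case: eqP => //= _ /andP[].
rewrite /= in pe *; case: ifP pe => fd /= pe.
  case/andP: pe => ae pe; rewrite ae !big_map.
  transitivity (\sum_(T <- terms s)
      ratfun_monomial (z d) ^+ e d * term_value e (e d) s T).
    rewrite -mulr_sumr -IH // mulr_sumr; apply: eq_bigr => x _.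
    by rewrite big_cons.
  apply: eq_bigr => T _; rewrite /term_value /= fd rcons_cons big_cons eqxx /=.
  rewrite ratfun_monomial0 expr1n mulr1 ratfun_monomialD exprMn.
  rewrite [in RHS](eq_big_seq (fun d' => ratfun_monomial (T.2 d') ^+ e d')).
    by rewrite -!mulrA mulrCA.
  by move=> d' d'F; case: eqP => // d'd; rewrite d'd (negPf dF) in d'F.
rewrite big_allpairs_dep big_flatten big_map /=.
set f := next_fixed fixed top s.
have fF : f \in rcons (filter fixed s) top.
  by rewrite /f /next_fixed; case: (filter _ _) => [|d' F] /=; rewrite mem_head.
have uF : uniq (rcons (filter fixed s) top).
  move: us; rewrite !rcons_uniq mem_filter => /andP[ts us].
  by rewrite (negPf ts) andbF filter_uniq.
have pf v : (v < e f)%N -> path ltn v (map e (rcons (filter fixed s) top)).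
  move: pe; rewrite /f /next_fixed.
  by case: (filter fixed s) => [|d' F] /= /andP[_ pF] ->.
have af : (a < e f)%N.
  move: pe; rewrite (path_sortedE ltn_trans) => /andP[/allP h _].
  by apply: h; apply: map_f.
have ft : (e f <= e top)%N.
  move: pe; rewrite /f /next_fixed; case: (filter fixed s) => [//|d' F] /=.
  rewrite (path_sortedE ltn_trans) => /and3P[_ /allP h _].
  by apply/ltnW/h/map_f; rewrite mem_rcons mem_head.
(* values from the next prescribed one on leave no filling of s *)
rewrite (big_cat_nat _ (n := e f)) //= [X in _ + X]big_nat_cond.
rewrite [X in _ + X]big1 ?addr0; last first.
  move=> v /andP[/andP[fv _] _]; rewrite fillings_nil ?big_nil //.
transitivity (\sum_(a.+1 <= v < e f) \sum_(T <- terms s)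
   ratfun_monomial (z d) ^+ v * term_value e v s T).
  apply: eq_big_nat => v /andP[av vf].
  rewrite -mulr_sumr -IH ?pf // mulr_sumr; apply: eq_bigr => x _.
  by rewrite big_cons.
rewrite exchange_big; apply: eq_bigr => T _ /=.
rewrite !big_cons big_nil addr0 /term_value /= fd.
set u := (z d + T.1.2)%MM; set P := \prod_(d' <- _) ratfun_monomial (T.2 d') ^+ _.
have u0 : 1 - ratfun_monomial u != 0.
  apply: ratfun_monomial_neq1; apply: contra zd.
  by rewrite /u mnmD_eq0 => /andP[].
transitivity (T.1.1 * P * \sum_(a.+1 <= v < e f) ratfun_monomial u ^+ v).
  rewrite mulr_sumr; apply: eq_bigr => v _.
  by rewrite /u ratfun_monomialD exprMn [X in _ * X = _]mulrAC mulrCA.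
rewrite sum_geometric //.
have -> : \prod_(d' <- rcons (filter fixed s) top)
    ratfun_monomial (if d' == f then (u + T.2 d')%MM else T.2 d') ^+ e d' =
    ratfun_monomial u ^+ e f * P.
  rewrite /P !(bigD1_seq f) //= eqxx ratfun_monomialD exprMn -!mulrA.
  by congr (_ * (_ * _)); apply: eq_bigr => d' /negPf ->.
rewrite ratfun_monomial0 expr1n.
exact: geometric_terms.
Qed.

End Monomials.

(** * The generating function as a sum over parents *)

Lemma fset_setP (T : choiceType) (S : set T) : finite_set S ->
  forall c, reflect (S c) (c \in fset_set S).
Proof.
move=> fS c; rewrite in_fset_set //; apply: (iffP idP); first exact: set_mem.
exact: mem_set.
Qed.

Section Recurrence.
Variable (B : set (seq nat)).
Implicit Types (p q x : seq nat) (c : seq nat * seq (nat * nat)).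

Definition cluster_list k p : {fset seq nat * seq (nat * nat)} :=
  fset_set (clusters_ending B k p).

Lemma cluster_listP k p c :
  reflect (clusters_ending B k p c) (c \in cluster_list k p).
Proof. exact/fset_setP/finite_clusters_ending. Qed.

(** A cluster has only one set of tail values, so the sum over all possible sets
    disappears. *)
Lemma cluster_tail_gfE (A : comNzRingType) (t : A) k p (z : 'I_(size p) -> A) :
  cluster_tail_gf t B k p z =
  \sum_(c <- cluster_list k p) (t - 1) ^+ size c.2 *
    \prod_(j < size p) z j ^+ nth 0%N (tail_values c) j.
Proof.
rewrite /cluster_tail_gf.
transitivity (\sum_(x : (size p).-tuple 'I_k.+1 | path ltn 0%N (map val x))
  \sum_(c <- cluster_list k p | perm_eq (drop (k - size p) c.1) (map val x))
    (t - 1) ^+ size c.2 * \prod_(j < size p) z j ^+ tnth x j).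
  apply: eq_bigr => x _; rewrite -mulr_suml; congr (_ * _).
  rewrite /tail_weight fsbig_finite; last exact: finite_clusters_with_tail.
  rewrite -[RHS]big_filter; apply: perm_big; apply: uniq_perm.
  - exact: fset_uniq.
  - by rewrite filter_uniq // fset_uniq.
  move=> c; rewrite mem_filter.
  apply/(fset_setP (finite_clusters_with_tail _ _ _ _))/andP.
    by case=> Hc Hp Hx; split=> //; apply/cluster_listP.
  by case=> Hx /cluster_listP[Hc Hp].
rewrite (exchange_big_dep predT) //= big_seq [RHS]big_seq.
apply: eq_bigr => c /cluster_listP Hc.
have szv := size_tail_values Hc.
have pv := tail_values_path Hc.
have inr v : v \in tail_values c -> (v < k.+1)%N.
  rewrite mem_sort => /mem_factor.
  by rewrite (perm_iota_range _ (cluster_perm Hc.1)) ltnS => /andP[].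
have szt : size (map (@inord k) (tail_values c)) == size p.
  by rewrite size_map szv.
have valE : map val (Tuple szt) = tail_values c.
  rewrite -map_comp -[RHS]map_id; apply/eq_in_map => v /inr vk.
  by rewrite /= inordK.
rewrite (big_pred1 (Tuple szt)) /=; last first.
  move=> x; rewrite /= -(tail_wordE Hc); apply/andP/eqP => [[px tx]|->].
    apply/val_inj/(inj_map val_inj); rewrite [RHS]valE.
    apply: (sorted_eq leq_trans anti_leq).
    - exact: (sub_sorted ltnW (path_sorted px)).
    - exact: sort_sorted leq_total _.
    - by rewrite perm_sym perm_sort.
  rewrite [map _ _]valE; split; last by rewrite perm_sym perm_sort.
  by move: pv; rewrite rcons_path => /andP[].
congr (_ * _); apply: eq_bigr => j _; congr (_ ^+ _).
by rewrite -[in RHS]valE (nth_map ord0) ?size_tuple // -tnth_nth.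
Qed.

Lemma cluster_tail_gf_eq (A : comNzRingType) (t : A) k p (z z' : 'I_(size p) -> A) :
  z =1 z' -> cluster_tail_gf t B k p z = cluster_tail_gf t B k p z'.
Proof. by move=> /funext ->. Qed.

Definition tails k p q o c : seq (seq nat) :=
  fillings (mem (take o p)) (forced_value k p q o (tail_values c))
    (size p).+1 0 (iota 1 (size p)).

Lemma tailsP k p q o c x : perm_eq p (iota 1 (size p)) ->
  reflect (valid_tail k p q o c x) (x \in tails k p q o c).
Proof.
move=> pp; rewrite /tails mem_fillings size_iota {1}/forced_value eqxx.
apply: (iffP and3P) => -[sx px ax].
  split=> //; first exact/eqP.
  move=> v vt; have := mem_take vt; rewrite (perm_iota_range _ pp) => vp.
  move/(all_nthP (0, 0)%N): ax => /(_ v.-1).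
  rewrite size_zip size_iota (eqP sx) minnn nth_zip ?size_iota ?(eqP sx) //=.
  rewrite nth_iota; last by lia.
  rewrite add1n prednK; last by lia.
  by rewrite vt /= => h; apply/eqP/h; lia.
split=> //; first by rewrite sx.
apply/(all_nthP (0, 0)%N) => i; rewrite size_zip size_iota sx minnn => ip.
rewrite nth_zip ?size_iota ?sx //= nth_iota // add1n.
by apply/implyP => /ax /= ->.
Qed.

Hypothesis hB : pattern_set B.

(** Extensions of clusters of pattern q by overlap o, up to the bijection of
    [parent] and [extend]. *)
Lemma sum_siblings (A : comNzRingType) (G : nat -> seq nat -> A) k p q o :
  B p -> (size p < k)%N -> compatible p q o ->
  \sum_(c <- cluster_list k p | (parent_pattern c == q) && (overlap k p c == o))
     G (size c.2) (tail_values c) =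
  \sum_(c <- cluster_list (k - size p + o) q) \sum_(x <- tails k p q o c)
     G (size c.2).+1 x.
Proof.
move=> hp pk hcomp; have pp : perm_eq p (iota 1 (size p)) := hB.1 p hp.
pose L := [seq c <- cluster_list k p |
   (parent_pattern c == q) && (overlap k p c == o)].
pose D := [seq (c, x) | c <- (cluster_list (k - size p + o) q : seq _),
                        x <- tails k p q o c].
transitivity (\sum_(d <- D) G (size d.1.2).+1 d.2); last first.
  by rewrite big_allpairs_dep.
rewrite -big_filter -/L.
have LP c : c \in L ->
    [/\ clusters_ending B k p c, parent_pattern c = q & overlap k p c = o].
  by rewrite mem_filter => /andP[/andP[/eqP-> /eqP->] /cluster_listP].
have -> : \sum_(c <- L) G (size c.2) (tail_values c) =
    \sum_(d <- [seq (parent c, tail_values c) | c <- L]) G (size d.1.2).+1 d.2.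
  rewrite big_map big_seq [RHS]big_seq; apply: eq_bigr => c /LP[Hc _ _] /=.
  have [wE _ _ _ _] := parent_spec hB Hc pk.
  by rewrite {1}wE size_rcons.
apply: perm_big; apply: uniq_perm.
- rewrite map_inj_in_uniq ?filter_uniq ?fset_uniq // => c d.
  move=> /LP[Hc _ oc] /LP[Hd _ od] [e1 e2 e3].
  rewrite -(extend_parent hB Hc pk) -(extend_parent hB Hd pk) oc od e3.
  by congr extend; rewrite /parent e1 e2.
- apply: allpairs_uniq_dep => [|c _|]; [exact: fset_uniq|exact: uniq_fillings|].
  by move=> [c x] [d y] _ _ /= [<- <-].
move=> [c x]; apply/mapP/allpairsPdep => [[d /LP[Hd dq dko] [-> ->]]|].
  exists (parent d), (tail_values d); split=> //.
    by apply/cluster_listP; rewrite -dko -dq; exact: (parent_ending hB Hd pk).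
  by apply/tailsP => //; rewrite -dko -dq; exact: (parent_valid hB Hd pk).
case=> d [y [/cluster_listP Hd /(tailsP _ _ _ _ _ pp) Hy [-> ->]]].
exists (extend k p o d y).
  rewrite mem_filter (parent_pattern_extend hB pk hp Hd hcomp Hy) eqxx.
  rewrite (overlap_extend hB pk hp Hd hcomp Hy) eqxx /=.
  by apply/cluster_listP; exact: (extend_ending hB pk hp Hd hcomp Hy).
by rewrite (parent_extend hB pk hp Hd hcomp Hy) (tail_values_extend hB pk hp Hd hcomp Hy).
Qed.

(** A list Q containing all the patterns of length at most k suffices: the
    parent of a cluster of length k is shorter than k. *)
Lemma sum_by_parent (A : comNzRingType) (G : nat -> seq nat -> A) k p
    (Q : seq (seq nat)) :
  B p -> (size p < k)%N -> uniq Q ->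
  (forall q, B q -> (size q <= k)%N -> q \in Q) ->
  \sum_(c <- cluster_list k p) G (size c.2) (tail_values c) =
  \sum_(q <- Q) \sum_(o <- iota 1 (size p).-1 | compatible p q o)
    \sum_(c <- cluster_list (k - size p + o) q) \sum_(x <- tails k p q o c)
      G (size c.2).+1 x.
Proof.
move=> hp pk uQ BQ.
transitivity (\sum_(q <- Q) \sum_(o <- iota 1 (size p).-1 | compatible p q o)
   \sum_(c <- cluster_list k p | (parent_pattern c == q) && (overlap k p c == o))
     G (size c.2) (tail_values c)); last first.
  by apply: eq_bigr => q _; apply: eq_bigr => o oq; rewrite -sum_siblings.
rewrite (eq_bigr (fun q => \sum_(c <- cluster_list k p)
    \sum_(o <- iota 1 (size p).-1 | compatible p q o)
      if (parent_pattern c == q) && (overlap k p c == o)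
      then G (size c.2) (tail_values c) else 0)); last first.
  by move=> q _; rewrite exchange_big; apply: eq_bigr => o _; rewrite big_mkcond.
rewrite exchange_big big_seq [RHS]big_seq /=; apply: eq_bigr => c /cluster_listP Hc.
have [o0 o1 o2] := overlap_bounds hB Hc pk.
have qQ : parent_pattern c \in Q.
  apply: BQ; first exact: parent_pattern_in Hc pk.
  rewrite (size_parent_pattern hB Hc pk).
  by have [_ _ l1 l2 _] := parent_spec hB Hc pk; rewrite -(parent_overlap hB Hc pk); lia.
rewrite (bigD1_seq (parent_pattern c)) //= big_mkcond.
rewrite (bigD1_seq (overlap k p c)) ?iota_uniq //=; last first.
  by rewrite mem_iota; lia.
rewrite (parent_compatible hB Hc pk) !eqxx /= big1 ?addr0; last first.
  by move=> o oc; rewrite eq_sym (negPf oc); case: ifP.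
rewrite big1 ?addr0 // => q qc; rewrite big1 // => o _.
by rewrite eq_sym (negPf qc).
Qed.
End Recurrence.

(** * The functional equation *)

(** Compatibility makes the parent's values increase along the overlap, and the
    number of new values below v is monotone in v; so the prescribed values
    increase strictly, as the closed formula for the sum over x requires. *)
Lemma forced_value_path (B : set (seq nat)) k (p q : seq nat) o c :
  perm_eq p (iota 1 (size p)) -> (size p < k)%N ->
  compatible p q o -> clusters_ending B (k - size p + o) q c ->
  path ltn 0%N (map (forced_value k p q o (tail_values c))
    (rcons (filter (mem (take o p)) (iota 1 (size p))) (size p).+1)).
Proof.
move=> pp pk /and4P[o0 op oq hc] Hc.
set e := forced_value _ _ _ _ _.
have pq : perm_eq q (iota 1 (size q)) := is_perm_ending Hc.
have up := perm_iota_uniq pp.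
have pr (v : nat) : v \in take o p -> (0 < v <= size p)%N.
  by move=> vt; rewrite -(perm_iota_range _ pp) (mem_take vt).
have src (v : nat) : v \in take o p -> (0 < source p q o v <= size q)%N.
  move=> vt; rewrite -(perm_iota_range _ pq) mem_nth //.
  rewrite -[X in (_ < X)%N](subnK (ltnW oq)) ltn_add2l.
  by rewrite -in_take // (mem_take vt).
have eE (v : nat) : v \in take o p -> e v =
    (nth 0 (tail_values c) (source p q o v).-1 + rank (drop o p) v)%N.
  move=> vt; rewrite /e /forced_value ifN //.
  by rewrite neq_ltn ltnS; case/andP: (pr v vt) => _ ->.
have y_range (v : nat) : v \in take o p ->
    (0 < nth 0 (tail_values c) (source p q o v).-1 <= k - size p + o)%N.
  move=> /src sv; rewrite -(perm_iota_range _ (cluster_perm Hc.1)).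
  apply: (@mem_factor _ (last_interval c).1 (last_interval c).2).
  by rewrite -/(tail_word c) -(mem_sort leq) mem_nth // (size_tail_values Hc); lia.
have lt_nth := sorted_ltn_nth ltn_trans 0%N (tail_values_sorted Hc.1).
set F := filter _ _.
have FE (v : nat) : v \in F -> v \in take o p by rewrite mem_filter => /andP[].
rewrite map_rcons rcons_path; apply/andP; split; last first.
  rewrite {2}/e /forced_value eqxx.
  case E : (map e F) => [//|a s] /=.
  have : last a s \in map e F by rewrite E mem_last.
  case/mapP => v /FE vt ->; rewrite ltnS eE //.
  have := y_range v vt.
  have : (rank (drop o p) v <= size p - o)%N by rewrite -size_drop count_size.
  lia.
rewrite (path_sortedE ltn_trans); apply/andP; split.
  by apply/allP => _ /mapP[v /FE vt ->]; rewrite eE //=; have := y_range v vt; lia.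
rewrite sorted_map.
have : sorted ltn F by rewrite sorted_filter ?iota_ltn_sorted //; exact: ltn_trans.
apply: (@sub_in_sorted _ (mem F)); last exact/allP.
move=> v w /FE vt /FE wt vw /=; rewrite !eE //.
have ltvw : (source p q o v < source p q o w)%N.
  by move/allP/(_ v vt)/allP/(_ w wt)/implyP: hc; apply.
have := lt_nth (source p q o v).-1 (source p q o w).-1.
have sv := src v vt; have sw := src w wt.
rewrite !inE (size_tail_values Hc) => h.
have {}h := h _ _ _.
have : (rank (drop o p) v <= rank (drop o p) w)%N.
  by apply: sub_count => y /= yv; apply: leq_trans yv _; exact: ltnW.
have : (nth 0 (tail_values c) (source p q o v).-1 <
        nth 0 (tail_values c) (source p q o w).-1)%N by apply: h; lia.
lia.
Qed.

Section Equation.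
Variable p : seq nat.

(** The variable z_d, for d counted from 1, as in x_1 < ... < x_m. *)
Definition slot_monomial (d : nat) : 'X_{1..size p} :=
  [multinom (j.+1 == d : nat) | j < size p].

Lemma slot_monomialE (j : 'I_(size p)) : slot_monomial j.+1 = U_(j)%MM.
Proof. by apply/mnmP => i; rewrite mnmE mnm1E eq_sym eqSS. Qed.

Lemma slot_monomial_neq0 d : d \in iota 1 (size p) -> slot_monomial d != 0%MM.
Proof.
rewrite mem_iota => /andP[d0 dp].
have jp : (d.-1 < size p)%N by lia.
apply/eqP => /mnmP/(_ (Ordinal jp)); rewrite mnmE mnm0E /= prednK // eqxx.
by [].
Qed.

Definition overlap_terms o : seq (term (size p)) :=
  terms (mem (take o p)) (size p).+1 slot_monomial (iota 1 (size p)).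

Definition overlap_slots o := filter (mem (take o p)) (iota 1 (size p)).

(** The factors of a term whose exponents do not involve the parent: the upper
    bound k + 1, and the numbers of new values below the prescribed ones. *)
Definition coefficient o (T : term (size p)) k : ratfun (size p) :=
  T.1.1 * ratfun_monomial (T.2 (size p).+1) ^+ k.+1 *
  \prod_(d <- overlap_slots o) ratfun_monomial (T.2 d) ^+ rank (drop o p) d.

(** The total exponent of y_(j+1).  At most one prescribed position has j + 1 as
    its source; summing over all positions avoids inverting [source]. *)
Definition argument q o (T : term (size p)) (j : nat) : 'X_{1..size p} :=
  (\sum_(d <- overlap_slots o | (source p q o d).-1 == j) T.2 d)%MM.

(** The closed formula of [sum_fillings], with the powers sorted by the tail
    values of the parent on which their exponents depend. *)
Lemma sum_tails (B : set (seq nat)) k q o c :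
  perm_eq p (iota 1 (size p)) -> (size p < k)%N ->
  compatible p q o -> clusters_ending B (k - size p + o) q c ->
  \sum_(x <- tails k p q o c) \prod_(j < size p) ratfun_var j ^+ nth 0%N x j =
  \sum_(T <- overlap_terms o) coefficient o T k *
    \prod_(j < size q)
      ratfun_monomial (argument q o T j) ^+ nth 0%N (tail_values c) j.
Proof.
move=> pp pk hc Hc.
transitivity (\sum_(x <- tails k p q o c)
  \prod_(dv <- zip (iota 1 (size p)) x)
    ratfun_monomial (slot_monomial dv.1) ^+ dv.2).
  rewrite big_seq [RHS]big_seq; apply: eq_bigr => x /(tailsP _ _ _ _ _ pp)[sx _ _].
  rewrite (big_nth (0, 0)%N) size_zip size_iota sx minnn big_mkord.
  apply: eq_bigr => j _; rewrite nth_zip ?size_iota ?sx //= nth_iota // add1n.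
  by rewrite slot_monomialE.
rewrite sum_fillings; first last.
- exact: forced_value_path Hc.
- exact: slot_monomial_neq0.
- by rewrite rcons_uniq iota_uniq mem_iota add1n ltnn andbF.
apply: eq_bigr => T _; rewrite /term_value expr0 mulr1 /coefficient.
rewrite -/(overlap_slots o) -cats1 big_cat big_seq1 /= {2}/forced_value eqxx.
rewrite [in LHS]mulrA [in LHS]mulrAC [in LHS]mulrC.
rewrite -[RHS]mulrA [RHS]mulrC; congr (_ * _).
have src d : d \in overlap_slots o -> ((source p q o d).-1 < size q)%N.
  rewrite mem_filter => /andP[dt _]; case/and4P: hc => o0 op oq _.
  have pq := is_perm_ending Hc.
  have : (0 < source p q o d <= size q)%N.
    rewrite -(perm_iota_range _ pq) mem_nth //.
    rewrite -[X in (_ < X)%N](subnK (ltnW oq)) ltn_add2l.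
    by rewrite -in_take // (mem_take dt).
  lia.
under [X in _ = _ * X]eq_bigr do
  rewrite /argument ratfun_monomial_sum -prodrXl.
rewrite (exchange_big_dep predT) //= -big_split /= big_seq [RHS]big_seq.
apply: eq_bigr => d ds; rewrite (big_pred1 (Ordinal (src d ds))) /=; last first.
  by move=> j; rewrite /= -val_eqE eq_sym.
rewrite -exprD addnC; congr (_ ^+ _); rewrite /forced_value ifN //.
move: ds; rewrite mem_filter mem_iota => /andP[_ /andP[_ dp]].
by rewrite neq_ltn; move: dp; rewrite add1n => ->.
Qed.

End Equation.

(** The sums over parents and over terms are exchanged: F T gathers what the
    term T contributes for all parents c, apart from its coefficient and from
    the factor s of the additional interval. *)
Lemma sum_regroup (K : fieldType) (s : {poly K}) (C X : eqType) (TT : Type)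
    (cs : seq C) (xs : C -> seq X) (ts : seq TT) (n : C -> nat)
    (a b : nat) (v : 'I_a -> K) (w : TT -> 'I_b -> K) (coef : TT -> K)
    (ex : X -> 'I_a -> nat) (ey : C -> 'I_b -> nat) (F : TT -> {poly K}) :
  (forall T, F T =
     \sum_(c <- cs) s ^+ n c * \prod_(j < b) (w T j)%:P ^+ ey c j) ->
  (forall c, c \in cs ->
     \sum_(x <- xs c) \prod_(j < a) v j ^+ ex x j =
     \sum_(T <- ts) coef T * \prod_(j < b) w T j ^+ ey c j) ->
  \sum_(c <- cs) \sum_(x <- xs c)
     s ^+ (n c).+1 * \prod_(j < a) (v j)%:P ^+ ex x j =
  s * \sum_(T <- ts) (coef T)%:P * F T.
Proof.
move=> FE.
have prodC (r : nat) (u : 'I_r -> K) (d : 'I_r -> nat) :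
    \prod_(j < r) (u j)%:P ^+ d j = (\prod_(j < r) u j ^+ d j)%:P.
  by rewrite rmorph_prod; apply: eq_bigr => j _; rewrite rmorphXn.
move=> E; transitivity (\sum_(c <- cs) \sum_(T <- ts)
    s ^+ (n c).+1 * (coef T * \prod_(j < b) w T j ^+ ey c j)%:P).
  rewrite big_seq [RHS]big_seq; apply: eq_bigr => c /E Ec.
  rewrite -!mulr_sumr -rmorph_sum -Ec rmorph_sum; congr (_ * _).
  by apply: eq_bigr => x _; rewrite prodC.
rewrite exchange_big mulr_sumr; apply: eq_bigr => T _ /=.
rewrite FE !mulr_sumr; apply: eq_bigr => c _.
by rewrite prodC exprS rmorphM -!mulrA; congr (_ * _); rewrite mulrCA.
Qed.

Theorem theorem3 (B : set (seq nat)) (p : seq nat)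
    (hB : pattern_set B) (hp : B p) :
  exists (I : seq nat -> {fset nat})
         (R : nat -> nat -> ratfun (size p))
         (M : nat -> nat -> 'X_{1..(size p)})
         (kappa : nat -> nat -> nat),
    (forall q q' : seq nat, B q -> B q' -> q <> q' ->
       [disjoint I q & I q']%fset) /\
    (forall k : nat, (0 < k)%N -> k <> size p ->
       (forall (q : seq nat) (i : nat), B q -> i \in I q -> (kappa i k < k)%N) /\
       cluster_tail_gf ('X : {poly ratfun (size p)}) B k p
           (fun j : 'I_(size p) => (ratfun_var j)%:P)
       = ('X - 1) *
         \sum_(q \in B) \sum_(i <- I q)
            (R i k)%:P *
            cluster_tail_gf ('X : {poly ratfun (size p)}) B (kappa i k) q
              (fun j : 'I_(size q) => (ratfun_monomial (M i j))%:P)).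
Proof.
have pp : perm_eq p (iota 1 (size p)) := hB.1 p hp.
(* the default in [dec] is never met on an index set *)
pose idx q o l : nat := choice.pickle (q : seq nat, (o : nat, l : nat)).
pose dec i : seq nat * (nat * nat) := odflt ([::], (0, 0)%N) (choice.unpickle i).
have idxK q o l : dec (idx q o l) = (q, (o, l)) by rewrite /dec choice.pickleK.
pose T0 : term (size p) := (0, 0%MM, fun=> 0%MM).
pose tm o l := nth T0 (overlap_terms p o) l.
pose S q := [seq idx q o l | o <- [seq o <- iota 1 (size p).-1 | compatible p q o],
                             l <- iota 0 (size (overlap_terms p o))].
pose R i k := let: (q, (o, l)) := dec i in
  if (k < size p)%N then 0 else coefficient o (tm o l) k.
pose M i j := let: (q, (o, l)) := dec i in argument q o (tm o l) j.
pose kappa i k := let: (q, (o, l)) := dec i in (k + o - size p)%N.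
exists (fun q => [fset i in S q]%fset), R, M, kappa; split.
  move=> q q' _ _ qq'; apply/fdisjointP => i; rewrite !inE /=.
  case/allpairsPdep => o [l [_ _ ->]]; apply/negP.
  case/allpairsPdep => o' [l' [_ _ /(congr1 dec)]]; rewrite !idxK.
  by case=> /qq'.
move=> k k0 kp.
have kappa_lt q i : i \in S q -> (kappa i k < k)%N.
  case/allpairsPdep => o [l [+ _ ->]]; rewrite /kappa idxK.
  by rewrite mem_filter mem_iota => /andP[_ /andP[o0 o1]]; lia.
split; first by move=> q i _; rewrite !inE; exact: kappa_lt.
case: (ltnP k (size p)) => [ltkp|lepk].
  rewrite cluster_tail_gf_eq0 // fsbig1 ?mulr0 // => q _.
  apply: big1 => i _; rewrite /R; case: (dec i) => _ [o l].
  by rewrite ltkp mul0r.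
have pk : (size p < k)%N by rewrite ltn_neqAle lepk eq_sym andbT; apply/eqP.
have RE q o l : R (idx q o l) k = coefficient o (tm o l) k.
  by rewrite /R idxK ltnNge lepk.
have kappaE q o l : kappa (idx q o l) k = (k - size p + o)%N.
  by rewrite /kappa idxK addnBAC.
(* B may be infinite, but only its patterns of length at most k matter *)
pose Q := undup [seq q <- [seq q | n <- iota 0 k.+1, q <- permutations (iota 1 n)]
                   | `[< B q >]].
have QP q : (q \in Q) = `[< B q >] && (size q <= k)%N.
  rewrite mem_undup mem_filter; case: asboolP => // Bq; rewrite !andTb.
  apply/allpairsPdep/idP => [[n [r [+ + ->]]]|qk].
    rewrite mem_iota mem_permutations => nk rn.
    by rewrite (perm_iota_size rn); lia.
  exists (size q), q; rewrite mem_iota mem_permutations; split=> //.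
  exact: hB.1.
set H := fun q => \sum_(i <- _) _.
have -> : \sum_(q \in B) H q = \sum_(q <- Q) H q.
  rewrite (fsbigE Q); first last.
  - move=> q Bq; rewrite QP asboolT //= -ltnNge => kq.
    rewrite /H big_seq big1 // => i; rewrite !inE => iS.
    by rewrite cluster_tail_gf_eq0 ?mulr0 // (ltn_trans (kappa_lt q i iS)).
  - by move=> q /=; rewrite QP => /andP[/asboolP].
  - exact: undup_uniq.
  rewrite big_seq_cond [RHS]big_seq; apply: eq_bigl => q.
  rewrite QP; case: asboolP => //= Bq; rewrite mem_set ?andbT //.
rewrite cluster_tail_gfE.
rewrite (sum_by_parent hB (fun r x => ('X - 1) ^+ r *
  \prod_(j < size p) (ratfun_var j)%:P ^+ nth 0%N x j)
  (Q := Q) hp pk (undup_uniq _)); last first.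
  by move=> q Bq qk; rewrite QP qk asboolT.
rewrite mulr_sumr; apply: eq_bigr => q _.
have -> : H q = \sum_(o <- iota 1 (size p).-1 | compatible p q o)
    \sum_(T <- overlap_terms p o) (coefficient o T k)%:P *
      cluster_tail_gf ('X : {poly ratfun (size p)}) B (k - size p + o) q
        (fun j : 'I_(size q) => (ratfun_monomial (argument q o T j))%:P).
  rewrite /H (perm_big (S q)) /=; last first.
    apply: uniq_perm; first exact: fset_uniq.
      apply: allpairs_uniq_dep => [|o _|]; rewrite ?filter_uniq ?iota_uniq //.
      move=> [o l] [o' l'] _ _ /= /(congr1 dec); rewrite !idxK.
      by case=> -> ->.
    by move=> i; rewrite !inE.
  rewrite big_allpairs_dep big_filter; apply: eq_bigr => o _.
  rewrite [RHS](big_nth T0) -/(index_iota 0 _) /index_iota subn0.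
  apply: eq_bigr => l _; rewrite RE kappaE.
  apply: (f_equal2 _ (erefl _)); apply: cluster_tail_gf_eq => j.
  by rewrite /M idxK.
rewrite mulr_sumr; apply: eq_bigr => o hc.
apply: sum_regroup => [T|c /cluster_listP Hc]; first exact: cluster_tail_gfE.
exact: sum_tails pp pk hc Hc.
Qed.
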